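(* Let $a<b$ be real numbers, let $u:[a,b]\to[0,\infty)$ be of bounded variation on $[a,b]$, and let $f:[a,b]\to\mathbb{R}$ be $L$-Lipschitzian on $[a,b]$. Then $$\left|\frac13\left\{\left[u\left(\tfrac{a+b}{2}\right)-u(a)\right]f(a)+2[u(b)-u(a)]f\left(\tfrac{a+b}{2}\right)+\left[u(b)-u\left(\tfrac{a+b}{2}\right)\right]f(b)\right\}-\int_a^b f(t)\,du(t)\right|\le\frac13L(b-a)\cdot\bigvee_a^b(u).$$ The constant $\frac13$ is the best possible, i.e. it cannot be replaced by a smaller constant for which the inequality still holds for all such $u,f$.
   Context: $\bigvee_a^b(u)$ denotes the total variation of $u$ over $[a,b]$. Integrals with respect to $du$ are Riemann–Stieltjes integrals. $f$ is $L$-Lipschitzian on $[a,b]$ if $|f(s)-f(t)|\le L|s-t|$ for all $s,t\in[a,b]$. *)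

(* Defs.v *)
From HB Require Import structures.
From mathcomp Require Import all_boot all_order all_algebra.
From mathcomp Require Import all_classical all_reals all_analysis.

Set Implicit Arguments.
Unset Strict Implicit.
Unset Printing Implicit Defensive.

Import Order.TTheory GRing.Theory Num.Theory.
Import numFieldNormedType.Exports.

Local Open Scope classical_set_scope.
Local Open Scope ring_scope.

(* As in [itv_partition] and [variation], the points of a partition
   a = x_0 < x_1 < ... < x_n = b are listed without the first one: s = x_1 .. x_n,
   so that x_i = nth b (a :: s) i.  Only the tags t 0, .., t (n - 1) matter. *)
Definition tagged_partition (R : realType) (a b : R) (s : seq R) (t : nat -> R) :=
  itv_partition a b s /\
  forall i : nat, (i < size s)%N ->
    nth b (a :: s) i <= t i <= nth b (a :: s) i.+1.

Definition mesh_lt (R : realType) (a b : R) (s : seq R) (d : R) :=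
  forall i : nat, (i < size s)%N ->
    nth b (a :: s) i.+1 - nth b (a :: s) i < d.

Definition RS_sum (R : realType) (a b : R) (f u : R -> R) (s : seq R)
    (t : nat -> R) : R :=
  \sum_(0 <= i < size s)
    f (t i) * (u (nth b (a :: s) i.+1) - u (nth b (a :: s) i)).

(* The Riemann-Stieltjes integral of f with respect to u, as the limit of the
   sums when the mesh of the partition tends to 0, uniformly in the tags. *)
Definition is_RS_integral (R : realType) (a b : R) (f u : R -> R) (I : R) :=
  forall e : R, 0 < e -> exists2 d : R, 0 < d &
    forall (s : seq R) (t : nat -> R),
      tagged_partition a b s t -> mesh_lt a b s d ->
      `|RS_sum a b f u s t - I| < e.

Definition RS_integrable (R : realType) (a b : R) (f u : R -> R) :=
  exists I : R, is_RS_integral a b f u I.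

(* Meaningful under [RS_integrable a b f u]; it is 0 otherwise. *)
Definition RS_integral (R : realType) (a b : R) (f u : R -> R) : R :=
  xget 0 [set I | is_RS_integral a b f u I].

Definition RS_quadrature (R : realType) (a b : R) (f u : R -> R) : R :=
  let m := (a + b) / 2 in
  1 / 3 * ((u m - u a) * f a + 2 * (u b - u a) * f m + (u b - u m) * f b).

(* Main.v *)
(* On [a, m], with m = (a + b) / 2, the quadrature integrates with respect to
   du the constant (f a + 2 f m) / 3, from which f differs by at most
   L (t - a) / 3 + 2 L (m - t) / 3 <= L (b - a) / 3; the interval [m, b] is
   symmetric.  Equality holds for u = 1_{a} and f t = t - a.
   The integral itself comes from a function J whose increments lie between
     f x (u y - u x) - L (y - x) (V y - V x)  and
     f x (u y - u x) + L (y - x) (V y - V x),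
   V being the variation of u: these bounds are respectively superadditive and
   subadditive functions of the interval [x, y], which is all one needs to find
   an additive function in between. *)

Require Import Defs.
From HB Require Import structures.
From mathcomp Require Import all_boot all_order all_algebra.
From mathcomp Require Import all_classical all_reals all_analysis.
From mathcomp Require Import ring lra.

Set Implicit Arguments.
Unset Strict Implicit.
Unset Printing Implicit Defensive.

Import Order.TTheory GRing.Theory Num.Theory.
Import numFieldNormedType.Exports.

Local Open Scope classical_set_scope.
Local Open Scope ring_scope.

(** * Additive functions squeezed between two interval functions *)

Inductive chain_sum (R : realType) (K : R -> R -> R) (a b : R) : R -> R -> Prop :=
| chain_sum_nil : chain_sum K a b a 0
| chain_sum_rcons x y s : chain_sum K a b x s -> x <= y -> y <= b ->
    chain_sum K a b y (s + K x y).

(* The infimum of the sums of [K] along the chains from [a] to [y] is a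
   suitable [J y]. *)
Lemma additive_between (R : realType) (K k : R -> R -> R) (a b : R) :
  a <= b ->
  (forall x y, a <= x -> x <= y -> y <= b -> k x y <= K x y) ->
  (forall x z y, a <= x -> x <= z -> z <= y -> y <= b ->
    K x z + K z y <= K x y) ->
  (forall x z y, a <= x -> x <= z -> z <= y -> y <= b ->
    k x y <= k x z + k z y) ->
  exists J : R -> R, forall x y, a <= x -> x <= y -> y <= b ->
    k x y <= J y - J x <= K x y.
Proof.
move=> ab kK Ksub ksup.
have chain_dom y s : chain_sum K a b y s -> a <= y <= b.
  elim=> [|x {}y {}s _ /andP[ax _] xy yb]; first by rewrite lexx.
  by rewrite yb (le_trans ax).
(* [Ksub] at [a], [a], [a] forces [K a a <= 0]. The empty chain, whose sum is 0, thus has a sum at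
   least [k a a]. *)
have kaa : k a a <= 0.
  by have := kK a a (lexx _) (lexx _) ab;
     have := Ksub a a a (lexx _) (lexx _) (lexx _) ab; lra.
(* A chain to [y] is cut at [x], which is inserted between its neighbours: this can only lower the
   sum of [K], and the links beyond [x] sum to at least [k x y]. *)
have chain_split y s : chain_sum K a b y s -> forall x, a <= x -> x <= y ->
    exists2 s', chain_sum K a b x s' & s' + k x y <= s.
  elim=> [x ax xa|z {}y {}s zs IH zy yb x ax xy].
    have -> : x = a by apply/le_anti; rewrite xa ax.
    by exists 0; [exact: chain_sum_nil | rewrite add0r].
  have /andP[az zb] := chain_dom _ _ zs.
  have [xz|/ltW zx] := leP x z.
    have [s' xs' s'_le] := IH x ax xz.
    exists s' => //.
    by have := ksup x z y ax xz zy yb; have := kK z y az zy yb; lra.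
  exists (s + K z x); first by apply: chain_sum_rcons => //; exact: le_trans yb.
  by have := Ksub z x y az zx xy yb; have := kK x y ax xy yb; lra.
have chain_ge y s : chain_sum K a b y s -> k a y <= s.
  elim=> [//|x {}y {}s xs IH xy yb].
  have /andP[ax xb] := chain_dom _ _ xs.
  by have := ksup a x y (lexx _) ax xy yb; have := kK x y ax xy yb; lra.
have chain_inf y s : chain_sum K a b y s -> inf [set t | chain_sum K a b y t] <= s.
  by move=> ys; apply: ge_inf => //; exists (k a y) => t; exact: chain_ge.
have chain_ex y : a <= y -> y <= b -> chain_sum K a b y (0 + K a y).
  by move=> ay yb; apply: chain_sum_rcons => //; exact: chain_sum_nil.
exists (fun y => inf [set s | chain_sum K a b y s]) => x y ax xy yb.
have xb := le_trans xy yb; have ay := le_trans ax xy.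
apply/andP; split.
  rewrite lerBrDr; apply: lb_le_inf; first by exists (0 + K a y); exact: chain_ex.
  move=> s /chain_split-/(_ x ax xy)[s' xs' s'_le].
  by have := chain_inf _ _ xs'; lra.
(* For the upper bound, any chain to [x] extends to [y] by one link, at cost [K x y]. *)
rewrite lerBlDr -lerBlDl; apply: lb_le_inf.
  by exists (0 + K a x); exact: chain_ex.
by move=> s xs; have := chain_inf _ _ (chain_sum_rcons xs xy yb); lra.
Qed.

(* [J] is a primitive of [f du] when [v] is a variation function of [u] and
   [L] a Lipschitz constant of [f]. *)
Definition RS_primitive (R : realType) (a b L : R) (f u v J : R -> R) :=
  forall x y, a <= x -> x <= y -> y <= b ->
    `|J y - J x - f x * (u y - u x)| <= L * (y - x) * (v y - v x).

(** * Primitives: existence, link with the integral, local estimate *)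

Section primitive.
Variables (R : realType) (a b L : R) (f u v : R -> R).
Hypothesis L0 : 0 <= L.
Hypothesis fL : forall x y, a <= x -> x <= y -> y <= b -> `|f y - f x| <= L * (y - x).
Hypothesis uv : forall x y, a <= x -> x <= y -> y <= b -> `|u y - u x| <= v y - v x.

Let v_ge x y : a <= x -> x <= y -> y <= b -> 0 <= v y - v x.
Proof. by move=> ax xy yb; apply: le_trans (uv ax xy yb). Qed.

Lemma RS_primitive_exists : a <= b -> exists J, RS_primitive a b L f u v J.
Proof.
move=> ab.
(* Splitting [f x * (u y - u x)] at [z] creates the error [(f z - f x) * (u y - u z)]. Splitting
   [L * (y - x) * (v y - v x)] loses two cross terms: one absorbs this error, the other is
   nonnegative by [Lvv]. *)
have fuv x z y : a <= x -> x <= z -> z <= y -> y <= b ->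
    `|(f z - f x) * (u y - u z)| <= L * (z - x) * (v y - v z).
  move=> ax xz zy yb; rewrite normrM; apply: ler_pM => //.
    by apply: fL => //; exact: le_trans yb.
  by apply: uv => //; exact: le_trans xz.
have Lvv x z y : a <= x -> x <= z -> z <= y -> y <= b ->
    0 <= L * (y - z) * (v z - v x).
  move=> ax xz zy yb; rewrite mulr_ge0 ?mulr_ge0 ?subr_ge0//.
  by rewrite -subr_ge0 v_ge// (le_trans zy).
pose K e x y := f x * (u y - u x) + e * (L * (y - x) * (v y - v x)).
have [|x z y ax xz zy yb|x z y ax xz zy yb|J Jk] :=
  @additive_between _ (K 1) (K (-1)) a b ab.
- move=> x y ax xy yb; rewrite /K.
  have : 0 <= L * (y - x) * (v y - v x) by rewrite !mulr_ge0 ?subr_ge0// -subr_ge0 v_ge.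
  lra.
- have := Lvv x z y ax xz zy yb; have := fuv x z y ax xz zy yb.
  by rewrite /K ler_norml => /andP[]; nra.
- have := Lvv x z y ax xz zy yb; have := fuv x z y ax xz zy yb.
  by rewrite /K ler_norml => /andP[]; nra.
exists J => x y ax xy yb; have := Jk x y ax xy yb; rewrite /K ler_norml.
by move=> /andP[? ?]; apply/andP; split; lra.
Qed.

Variable J : R -> R.
Hypothesis JP : RS_primitive a b L f u v J.

(** On each interval of the partition, moving the tag to the left end and replacing [f du] by the
    increment of [J] each cost at most [L * d] times the increment of [v]; the latter increments
    telescope. *)
Lemma RS_primitive_integral : a <= b -> is_RS_integral a b f u (J b - J a).
Proof.
move=> ab e e0.
have vab := v_ge (lexx a) ab (lexx b).
have D0 : 0 < 2 * L * (v b - v a) + 1 by rewrite ltr_wpDl ?mulr_ge0.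
(* The summand 1 keeps the denominator positive and makes the final bound, [e - d], strictly less
   than [e]. *)
exists (e / (2 * L * (v b - v a) + 1)); first by rewrite divr_gt0.
set d := e / _ => s t [[ps /eqP lsb] st] sd.
pose p i := nth b (a :: s) i.
have p0 : p 0 = a by [].
have pn : p (size s) = b by rewrite /p -last_nth.
have p_ab i : (i <= size s)%N -> a <= p i <= b.
  have sle : sorted <=%R (a :: s).
    by apply: sub_path ps => ? ?; exact: ltW.
  move=> ilt; apply/andP; split; [rewrite -[leLHS]p0 | rewrite -[leRHS]pn];
  by apply: (sorted_leq_nth le_trans lexx b sle); rewrite ?inE /= ?ltnS.
have telesc (g : R -> R) : g b - g a = \sum_(0 <= i < size s) (g (p i.+1) - g (p i)).
  by rewrite (telescope_sumr (fun i => g (p i))) // pn p0.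
rewrite /RS_sum (telesc J) -sumrB.
apply: (@le_lt_trans _ _ (\sum_(0 <= i < size s) (2 * L * d * (v (p i.+1) - v (p i))))).
  apply: le_trans (ler_norm_sum _ _ _) _.
  rewrite !big_mkord; apply: ler_sum => -[i /= ilt] _.
  have /andP[api pib] := p_ab i (ltnW ilt).
  have /andP[apS pSb] := p_ab i.+1 ilt.
  have /andP[pt tp] := st i ilt.
  rewrite -/(p i) -/(p i.+1) in pt tp *.
  have pp := le_trans pt tp.
  have pd : p i.+1 - p i < d := sd i ilt.
  have := JP api pp pSb; have := fL api pt (le_trans tp pSb).
  move=> fti Ji.
  have ftd : `|(f (t i) - f (p i)) * (u (p i.+1) - u (p i))| <=
      L * d * (v (p i.+1) - v (p i)).
    rewrite normrM ler_pM// ?uv//; apply: le_trans fti _.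
    by apply: ler_wpM2l => //; lra.
  have {}Ji : `|J (p i.+1) - J (p i) - f (p i) * (u (p i.+1) - u (p i))| <=
      L * d * (v (p i.+1) - v (p i)).
    apply: le_trans Ji _; apply: ler_wpM2r; first exact: v_ge.
    by apply: ler_wpM2l => //; lra.
  move: ftd Ji; rewrite !ler_norml => /andP[? ?] /andP[? ?].
  by apply/andP; split; lra.
rewrite -big_distrr /= -telesc.
have d0 : 0 < d by rewrite divr_gt0.
have dD : d * (2 * L * (v b - v a) + 1) = e by rewrite divfK ?gt_eqF.
lra.
Qed.

(** Bisection: the increments of [J], [u] and [v] add up over the two halves, while the error term
    [L * (s - r)] of the primitive is halved each time, so only [M] survives in the limit. No
    integral over a subinterval is involved. *)
Lemma RS_primitive_approx x y c M : a <= x -> x <= y -> y <= b ->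
  (forall t, x <= t -> t <= y -> `|f t - c| <= M) ->
  `|J y - J x - c * (u y - u x)| <= M * (v y - v x).
Proof.
move=> ax xy yb fM.
have approx n : forall r s, x <= r -> r <= s -> s <= y ->
    `|J s - J r - c * (u s - u r)| <= (M + L * (s - r) / 2 ^+ n) * (v s - v r).
  elim: n => [|n IH] r s xr rs sy.
    have [ar sb] : a <= r /\ s <= b by split; lra.
    have : `|(f r - c) * (u s - u r)| <= M * (v s - v r).
      by rewrite normrM ler_pM// ?fM ?uv// (le_trans rs).
    have := JP ar rs sb.
    rewrite expr0 divr1 !ler_norml => /andP[? ?] /andP[? ?].
    by apply/andP; split; lra.
  set m := (r + s) / 2.
  have [rm ms] : r <= m /\ m <= s by rewrite /m; split; lra.
  have := IH r m xr rm (le_trans ms sy); have := IH m s (le_trans xr rm) ms sy.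
  have -> : L * (s - m) / 2 ^+ n = L * (s - r) / 2 ^+ n.+1.
    by rewrite /m exprS; field; rewrite expf_neq0.
  have -> : L * (m - r) / 2 ^+ n = L * (s - r) / 2 ^+ n.+1.
    by rewrite /m exprS; field; rewrite expf_neq0.
  rewrite !ler_norml => /andP[? ?] /andP[? ?].
  by apply/andP; split; lra.
apply/ler_addgt0Pr => e e0.
set D := L * (y - x) * (v y - v x).
have D0 : 0 <= D by rewrite !mulr_ge0 ?subr_ge0// -subr_ge0 v_ge.
(* This depth suffices because [D / e < n <= 2 ^ n]. *)
pose n := Num.bound (D / e).
have := approx n x y (lexx _) xy (lexx _).
rewrite mulrDl mulrAC -/D => /le_trans; apply.
rewrite lerD2l ler_pdivrMr ?exprn_gt0// mulrC -ler_pdivrMr//.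
have := archi_boundP (divr_ge0 D0 (ltW e0)); rewrite -/n => /ltW/le_trans; apply.
by rewrite -natrX ler_nat ltnW// ltn_expl.
Qed.

End primitive.

(** * Uniqueness of the Riemann-Stieltjes integral *)

Lemma exists_fine_partition (R : realType) (a b d : R) : a < b -> 0 < d ->
  exists2 s, itv_partition a b s & mesh_lt a b s d.
Proof.
move=> ab d0.
have ba : 0 < b - a by rewrite subr_gt0.
pose n := Num.bound ((b - a) / d).
have bn : (b - a) / d < n%:R by apply: archi_boundP; rewrite divr_ge0 ?ltW.
have n0 : 0 < n%:R :> R by apply: le_lt_trans bn; rewrite divr_ge0 ?ltW.
pose p i : R := a + i%:R * ((b - a) / n%:R).
have pS i : p i.+1 = p i + (b - a) / n%:R by rewrite /p -natr1; ring.
have nthp i : (i <= n)%N -> nth b (a :: mkseq (fun i => p i.+1) n) i = p i.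
  by case: i => [|i] /= iN; [rewrite /p mul0r addr0 | rewrite nth_mkseq].
exists (mkseq (fun i => p i.+1) n).
  split.
    apply/(pathP b) => i; rewrite size_mkseq => iN.
    by rewrite nthp ?(ltnW iN)// nth_mkseq// pS ltrDl divr_gt0.
  by rewrite (last_nth b) size_mkseq nthp// /p; apply/eqP; field; rewrite gt_eqF.
move=> i; rewrite size_mkseq => iN.
by rewrite !nthp ?(ltnW iN)// pS addrAC subrr add0r ltr_pdivrMr// mulrC -ltr_pdivrMr.
Qed.

Lemma RS_integral_unique (R : realType) (a b : R) (f u : R -> R) (I I' : R) :
  a < b -> is_RS_integral a b f u I -> is_RS_integral a b f u I' -> I = I'.
Proof.
move=> ab fI fI'; apply/eqP; rewrite -subr_eq0 -normr_eq0; apply/eqP/le_anti.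
rewrite normr_ge0 andbT; apply/ler_addgt0Pr => e e0; rewrite add0r.
have e2 : 0 < e / 2 by rewrite divr_gt0.
have [d d0 dI] := fI _ e2; have [d' d'0 dI'] := fI' _ e2.
have mm : 0 < Num.min d d' by rewrite lt_min d0.
have [s ps sd] := exists_fine_partition ab mm.
(* Each interval is tagged at its left end. *)
have tagged : tagged_partition a b s (nth b (a :: s)).
  split=> // i ilt; rewrite lexx /= ltW//.
  by case: ps => /(pathP b)/(_ i ilt).
have : `|RS_sum a b f u s (nth b (a :: s)) - I| < e / 2.
  by apply: (dI _ _ tagged) => i ilt; apply: lt_le_trans (sd i ilt) _; rewrite ge_min lexx.
have : `|RS_sum a b f u s (nth b (a :: s)) - I'| < e / 2.
  by apply: (dI' _ _ tagged) => i ilt; apply: lt_le_trans (sd i ilt) _; rewrite ge_min lexx orbT.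
by rewrite !ltr_norml => /andP[? ?] /andP[? ?]; rewrite ler_norml; apply/andP; split; lra.
Qed.

Lemma RS_integralE (R : realType) (a b : R) (f u : R -> R) (I : R) :
  a < b -> is_RS_integral a b f u I -> RS_integral a b f u = I.
Proof.
move=> ab fI; apply: xget_unique => // I' fI'; exact: RS_integral_unique fI' fI.
Qed.

(** * The error bound for the quadrature *)

Lemma lipschitz_onP (R : realType) (a b L : R) (f : R -> R) :
  L.-lipschitz_(`[a, b]) f ->
  forall x y, a <= x -> x <= y -> y <= b -> `|f y - f x| <= L * (y - x).
Proof.
move=> fL x y ax xy yb; have := fL (y, x) _; rewrite /= [`|y - x|]ger0_norm ?subr_ge0//.
by apply; split; rewrite /= in_itv /=; apply/andP; split=> //; lra.
Qed.

(** By additivity, the right-hand side is the variation of [u] over [[x, y]]. Bounded variation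
    makes all the terms finite, so that [fine] respects this additivity. *)
Lemma dist_le_total_variation (R : realType) (a b : R) (u : R -> R) :
  bounded_variation a b u ->
  forall x y, a <= x -> x <= y -> y <= b ->
  `|u y - u x| <= fine (total_variation a y u) - fine (total_variation a x u).
Proof.
move=> bu x y ax xy yb.
have ay := le_trans ax xy; have ab := le_trans ay yb.
have fay : total_variation a y u \is a fin_num.
  by apply/bounded_variationP => //; exact: bounded_variationl bu.
move: fay; rewrite (total_variationD u ax xy) fin_numD => /andP[fax fxy].
rewrite fineD// addrAC subrr add0r -lee_fin fineK//.
exact: total_variation_ge.
Qed.

Lemma RS_quadrature_bound (R : realType) (a b L : R) (u f : R -> R) : a < b ->
  bounded_variation a b u -> L.-lipschitz_(`[a, b]) f ->
  RS_integrable a b f u /\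
  `|RS_quadrature a b f u - RS_integral a b f u|
    <= 1 / 3 * L * (b - a) * fine (total_variation a b u).
Proof.
move=> ab bu /lipschitz_onP fL.
pose v x := fine (total_variation a x u).
have uv : forall x y, a <= x -> x <= y -> y <= b -> `|u y - u x| <= v y - v x.
  exact: dist_le_total_variation.
have L0 : 0 <= L.
  have := le_trans (normr_ge0 _) (fL a b (lexx _) (ltW ab) (lexx _)).
  by rewrite pmulr_lge0 ?subr_gt0.
have [J JP] := RS_primitive_exists L0 fL uv (ltW ab).
have fI := RS_primitive_integral L0 fL uv JP (ltW ab).
split; first by exists (J b - J a).
rewrite (RS_integralE ab fI) /RS_quadrature.
set m := (a + b) / 2.
have [am mb] : a <= m /\ m <= b by rewrite /m; split; lra.
have left t : a <= t -> t <= m -> `|f t - (f a + 2 * f m) / 3| <= 1 / 3 * L * (b - a).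
  move=> at_ tm; have := fL a t (lexx _) at_ (le_trans tm mb); have := fL t m at_ tm mb.
  rewrite !ler_norml => /andP[? ?] /andP[? ?].
  (* The weighted bound [L * (t - a) / 3 + 2 * L * (m - t) / 3] equals
     [L * (b - a) / 3 - L * (t - a) / 3]. *)
  have Lta : 0 <= L * (t - a) by rewrite mulr_ge0 ?subr_ge0.
  have Lm : L * (2 * m) = L * (a + b) by rewrite /m; congr (_ * _); field.
  by apply/andP; split; lra.
have right t : m <= t -> t <= b -> `|f t - (2 * f m + f b) / 3| <= 1 / 3 * L * (b - a).
  move=> mt tb; have := fL m t am mt tb; have := fL t b (le_trans am mt) tb (lexx _).
  rewrite !ler_norml => /andP[? ?] /andP[? ?].
  have Lbt : 0 <= L * (b - t) by rewrite mulr_ge0 ?subr_ge0.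
  have Lm : L * (2 * m) = L * (a + b) by rewrite /m; congr (_ * _); field.
  by apply/andP; split; lra.
(* Writing [u b - u a] as [(u b - u m) + (u m - u a)] turns the quadrature into the sum of the two
   constants times the increments of [u] over the halves. *)
have := RS_primitive_approx L0 uv JP (lexx _) am mb left.
have := RS_primitive_approx L0 uv JP am mb (lexx _) right.
have -> : fine (total_variation a b u) = v b - v a.
  by rewrite /v total_variationxx subr0.
rewrite !ler_norml => /andP[? ?] /andP[? ?].
by apply/andP; split; lra.
Qed.

(** * Sharpness of the constant *)

Lemma RS_quadrature_sharp (R : realType) (a b : R) : a < b ->
  let u := fun x => (x == a)%:R : R in let f := fun x => x - a in
  [/\ bounded_variation a b u, 1.-lipschitz_(`[a, b]) f,
      fine (total_variation a b u) = 1 &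
      `|RS_quadrature a b f u - RS_integral a b f u| = (b - a) / 3].
Proof.
move=> ab u f.
have ua : u a = 1 by rewrite /u eqxx.
have u0 x : a < x -> u x = 0 by rewrite /u => /gt_eqF ->.
have uN x y : a <= x -> x <= y -> u y <= u x.
  rewrite le_eqVlt => /predU1P[<- _|ax xy]; first by rewrite ua /u lern1 leq_b1.
  by rewrite !u0// (lt_le_trans ax).
have tvu : total_variation a b u = 1%:E.
  rewrite -total_variationN nondecreasing_total_variation ?ltW//=.
    by rewrite ua u0// opprK oppr0 add0r.
  move=> x y; rewrite !in_itv /= => /andP[ax _] _ xy.
  by rewrite lerN2 uN.
(* The only jump of [u] is at [a], where [f] vanishes, so the zero function is a primitive; as [u]
   is nonincreasing on [[a, b]], [- u] serves as its variation function. *)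
have int0 : is_RS_integral a b f u 0.
  rewrite -(subrr (0 : R)); apply: (@RS_primitive_integral _ a b 1 f u (\- u) ler01) (ltW ab).
  - by move=> x y _ xy _; rewrite /f mul1r opprB addrA subrK ger0_norm ?subr_ge0.
  - by move=> x y ax xy _; rewrite /= opprK (addrC (- u y)) distrC ger0_norm// subr_ge0 uN.
  - move=> x y ax xy yb; rewrite /= subrr sub0r normrN.
    have -> : f x * (u y - u x) = 0.
      move: ax; rewrite le_eqVlt => /predU1P[<-|ax]; first by rewrite /f subrr mul0r.
      by rewrite !u0 ?subrr ?mulr0// (lt_le_trans ax).
    by rewrite normr0 mul1r mulr_ge0 ?subr_ge0//= lerN2 uN.
split.
- by apply/bounded_variationP; rewrite ?ltW// tvu.
- by move=> [x y] _; rewrite /= /f mul1r opprB addrA subrK.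
- by rewrite tvu.
(* Only the midpoint term contributes to the quadrature: [1 / 3 * 2 * (-1) * ((b - a) / 2)]. *)
rewrite (RS_integralE ab int0) /RS_quadrature.
have am : a < (a + b) / 2 by lra.
rewrite ua (u0 _ ab) (u0 _ am) /f.
rewrite (_ : _ - 0 = - ((b - a) / 3)); last by field.
by rewrite normrN ger0_norm// divr_ge0// subr_ge0 ltW.
Qed.

Theorem corollary6 (R : realType) (a b : R) (hab : a < b) :
  (forall (L : R) (u f : R -> R),
      (forall x : R, x \in `[a, b] -> 0 <= u x) ->
      bounded_variation a b u ->
      L.-lipschitz_(`[a, b]) f ->
      RS_integrable a b f u /\
      `|RS_quadrature a b f u - RS_integral a b f u|
        <= 1 / 3 * L * (b - a) * fine (total_variation a b u))
  /\
  (forall C : R,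
      (forall (L : R) (u f : R -> R),
          (forall x : R, x \in `[a, b] -> 0 <= u x) ->
          bounded_variation a b u ->
          L.-lipschitz_(`[a, b]) f ->
          `|RS_quadrature a b f u - RS_integral a b f u|
            <= C * L * (b - a) * fine (total_variation a b u)) ->
      1 / 3 <= C).
Proof.
split=> [L u f _ bu fL|C CP]; first exact: RS_quadrature_bound.
have [bu fL tvu err] := RS_quadrature_sharp hab.
(* With [L = 1] and variation 1, the assumed bound reads [(b - a) / 3 <= C * (b - a)]. *)
have := CP _ _ _ (fun x _ => ler0n _ _) bu fL.
rewrite tvu err mulr1 mulr1 => h.
by rewrite -(ler_pM2r (_ : 0 < b - a)) ?subr_gt0// mul1r mulrC.
Qed.
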